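(* Let $\mathcal H$ be a real Hilbert space, $f:\mathcal H\to\mathbb R\cup\{+\infty\}$ a proper closed convex function which has minimizers, $\theta>0$, and let $x_0\in\mathcal H$ be a point which is not a minimizer of $f$, with $f(x_0)<+\infty$. Let $(x,\lambda):[0,+\infty[\to\mathcal H\times\mathbb R_{++}$ be the unique global solution of $$\begin{cases}\dot x(t)+x(t)-(I+\lambda(t)\partial f)^{-1}x(t)=0,\quad \lambda(t)>0,\\ \lambda(t)\,\|(I+\lambda(t)\partial f)^{-1}x(t)-x(t)\|=\theta,\\ x(0)=x_0.\end{cases}$$ Let $\bar z\in\arg\min f$ satisfy $\|x_0-\bar z\|=d_0:=\inf\{\|x_0-z\|: z\text{ minimizes }f\}$, and set $\kappa=\sqrt{\theta/d_0^3}$. Then, for any $t\ge0$, $$f(x(t))-f(\bar z)\le\frac{f(x_0)-f(\bar z)}{\left[1+\dfrac{t\,\kappa\sqrt{f(x_0)-f(\bar z)}}{2+3\kappa\sqrt{f(x_0)-f(\bar z)}}\right]^2}.$$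
   Context: $\partial f$ is the convex subdifferential of $f$, a maximal monotone operator; $(\partial f)^{-1}(0)=\arg\min f$. The global solution $(x,\lambda)$ exists and is unique for every $x_0\notin\arg\min f$, with $x$ of class $\mathscr C^1$ and $\lambda$ locally Lipschitz continuous. *)

(* Defs.v *)
From HB Require Import structures.
From mathcomp Require Import all_boot all_order all_algebra.
From mathcomp Require Import all_classical all_reals all_analysis.
Set Implicit Arguments.
Unset Strict Implicit.
Unset Printing Implicit Defensive.
Import Order.TTheory GRing.Theory Num.Theory.
Import numFieldNormedType.Exports.
Local Open Scope classical_set_scope.
Local Open Scope ring_scope.

(** A real Hilbert space is a complete normed module [H] over [R : realType]
    with an inner product inducing its norm. [{dot H for idfun}] is the type of
    symmetric positive definite bilinear forms [H -> H -> R]. *)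
Definition induces_norm (R : realType) (H : completeNormedModType R)
    (dot : {dot H for (@idfun R)}) : Prop :=
  forall u : H, `|u| ^+ 2 = dot u u.

Section ExtendedValuedFunctions.
Context {R : realType} {H : completeNormedModType R}.
Implicit Types (f : H -> \bar R) (x y z : H).

(** Proper as a function to R U {+oo}: the value -oo is excluded. *)
Definition proper_fun f : Prop :=
  (forall x, f x != -oo%E) /\ (exists x, (f x < +oo)%E).

Definition closed_fun f : Prop :=
  closed [set p : H * R | (f p.1 <= p.2%:E)%E].

(** Since [0 * +oo = 0] in [\bar R], the endpoints [s = 0] and [s = 1] add no
    constraint. *)
Definition convex_fun f : Prop :=
  forall x y (s : R), 0 <= s <= 1 ->
    (f ((1 - s) *: x + s *: y)%R <= (1 - s)%:E * f x + s%:E * f y)%E.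

Definition argmin f : set H := [set z | forall y, (f z <= f y)%E].

(** For a proper [f], this set is empty when [f x = +oo]. *)
Definition subdifferential (dot : {dot H for (@idfun R)}) f x : set H :=
  [set u | forall y, (f x + (dot u (y - x))%:E <= f y)%E].

End ExtendedValuedFunctions.

Section Operators.
Context {R : realType} {H : completeNormedModType R}.
Implicit Types (T : H -> set H).

Definition op_inv T : H -> set H := fun y => [set x | T x y].

Definition id_add_scale (lam : R) T : H -> set H :=
  fun x => [set x + lam *: u | u in T x].

(** [(I + lam T)^-1] as a function; when [T] is maximal monotone and
    [0 < lam] the set below is a singleton for every [x], and the default value
    [0] is not used. *)
Definition resolvent (lam : R) T (x : H) : H :=
  xget 0 (op_inv (id_add_scale lam T) x).

End Operators.

(** Derivative at [t] of a map on [[0, +oo[]; one-sided at [t = 0], and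
    independent of the values of [x] at negative times. *)
Definition has_derivative_ge0 (R : realType) (H : completeNormedModType R)
    (x : R -> H) (t : R) (v : H) : Prop :=
  (s - t)^-1 *: (x s - x t) @[s --> within `[0, +oo[ t^'] --> v.

(** Maps on [[0, +oo[] are total on [R], their values at negative times are
    irrelevant. *)
Definition global_solution (R : realType) (H : completeNormedModType R)
    (T : H -> set H) (theta : R) (x0 : H) (x : R -> H) (lam : R -> R) : Prop :=
  (exists xdot : R -> H, forall t : R, 0 <= t ->
    [/\ has_derivative_ge0 x t (xdot t),
        xdot t + x t - resolvent (lam t) T (x t) = 0,
        0 < lam t
      & lam t * `|resolvent (lam t) T (x t) - x t| = theta])
  /\ x 0 = x0.

(* Main.v *)
Require Import Defs.
From HB Require Import structures.
From mathcomp Require Import all_boot all_order all_algebra.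
From mathcomp Require Import all_classical all_reals all_analysis.
From mathcomp Require Import ring lra.
Set Implicit Arguments.
Unset Strict Implicit.
Import Order.TTheory GRing.Theory Num.Theory.
Import numFieldNormedType.Exports.
Local Open Scope classical_set_scope.
Local Open Scope ring_scope.

(** Write [y t] for the proximal point [(I + lam t * df)^-1 (x t)], so that
    [x' = y - x] and [v := (x - y) / lam] is a subgradient of [f] at [y].

    If [f] could be differentiated along the trajectory, convexity would give
    [(f (x t))' <= f y - f x]. The gap [f x - f y] is at least [dot v (x - y) =
    lam |v|^2], which is [sqrt theta * |v|^(3/2)] because [lam^2 |v| = theta].
    The distance from [x t] to a minimizer does not increase
    ([dist_argmin_nonincreasing]), so [gamma := f y - min f <= |v| d0], and with
    [beta := f x - min f] this becomes [gamma + kappa gamma^(3/2) <= beta]. By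
    convexity of [g |-> g + kappa g^(3/2)] it implies [beta' <= - 2 k
    beta^(3/2)] where [k := kappa / (2 + 3 kappa sqrt (beta 0))]
    ([rate_inequality]); hence [1 / sqrt beta] grows at rate at least [k]
    ([power_decay]), which is the announced bound.

    But [f] is only lower semicontinuous, and [f (x t)] need not be
    differentiable. So [f] is replaced by its Moreau envelope [envelope mu x =
    min_z f z + |x - z|^2 / (2 mu)], which is squeezed between an affine
    function and the same function plus a quadratic term ([envelope_expansion]);
    this makes [envelope mu \o x] differentiable, with derivative at most [f y -
    envelope mu x]. The envelope loses only [mu |v|^2 / 2] in the lower bound
    for the gap ([envelope_ge_affine]). Since [|x - y| <= d0], the parameter
    [lam] is at least [theta / d0], and the loss amounts to multiplying [kappa]
    by [1 - mu d0 / (2 theta)] ([step_inequality], [envelope_gap]). When [mu]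
    tends to 0 the proximal points with parameter [mu] tend to [x t], and
    closedness of the epigraph of [f] carries the bound over to [f (x t)]
    ([value_decay]).

    The resolvent is a choice from a set, so all of this needs that set to be
    inhabited: [proximal_point] minimizes [f z + |x - z|^2 / (2 mu)] over the
    Hilbert space. *)

(** * Inner product inducing the norm *)

Section InnerProduct.
Context {R : realType} {H : completeNormedModType R}.
Context (dot : {dot H for (@idfun R)}) (hdot : induces_norm dot).
Implicit Types u v w : H.

Lemma dotC u v : dot u v = dot v u.
Proof. by rewrite (hermC dot) expr0 mul1r. Qed.

Lemma dotDl u v w : dot (u + v) w = dot u w + dot v w.
Proof. by rewrite linearDl. Qed.

Lemma dotNl u w : dot (- u) w = - dot u w.
Proof. by rewrite linearNl. Qed.

Lemma dotZl a u w : dot (a *: u) w = a * dot u w.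
Proof. by rewrite linearZl_LR. Qed.

Lemma dotDr u v w : dot w (u + v) = dot w u + dot w v.
Proof. by rewrite !(dotC w) dotDl. Qed.

Lemma dotNr u w : dot w (- u) = - dot w u.
Proof. by rewrite !(dotC w) dotNl. Qed.

Lemma dotZr a u w : dot w (a *: u) = a * dot w u.
Proof. by rewrite !(dotC w) dotZl. Qed.

Definition dotE := (dotDl, dotNl, dotZl, dotDr, dotNr, dotZr).

Lemma dot_ge0 u : 0 <= dot u u.
Proof. by rewrite -hdot sqr_ge0. Qed.

(** This is the triangle inequality for [u + v], squared. *)
Lemma dot_le_norm u v : dot u v <= `|u| * `|v|.
Proof.
have h : `|u + v| ^+ 2 <= (`|u| + `|v|) ^+ 2.
  by rewrite lerXn2r ?nnegrE ?addr_ge0 ?ler_normD.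
move: h; rewrite sqrrD !hdot !dotE (dotC v u); lra.
Qed.

Lemma cauchy_schwarz u v : `|dot u v| <= `|u| * `|v|.
Proof.
rewrite ler_norml dot_le_norm andbT lerNl -dotNl.
by rewrite -(normrN u) dot_le_norm.
Qed.

End InnerProduct.

(** * Existence of proximal points *)

Lemma le0_of_le_small (R : realFieldType) (X D : R) : 0 <= D ->
  (forall s, 0 < s <= 1 -> X <= s * D) -> X <= 0.
Proof.
move=> D0 h; rewrite leNgt; apply/negP => X0.
have XD : 0 < X + D by rewrite ltr_wpDr.
(* [s := X / (X + D)] would give [X <= X * D / (X + D) < X]. *)
have := h (X / (X + D)); rewrite divr_gt0//= ler_pdivrMr// mul1r lerDl.
move=> /(_ D0); rewrite mulrAC ler_pdivlMr//; nra.
Qed.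

Section Prox.
Context {R : realType} {H : completeNormedModType R}.
Context (dot : {dot H for (@idfun R)}) (hdot : induces_norm dot).
Context (f : H -> \bar R) (f_proper : proper_fun f) (f_closed : closed_fun f)
  (f_convex : convex_fun f).

Local Notation df := (subdifferential dot f).

Lemma fine_proper x r : (f x <= r%:E)%E -> f x = (fine (f x))%:E.
Proof.
move=> fx; rewrite fineK// fin_numE f_proper.1 /=.
by apply/eqP => e; rewrite e leye_eq in fx.
Qed.

Lemma convex_epigraph x y r r' s : 0 <= s <= 1 ->
  (f x <= r%:E)%E -> (f y <= r'%:E)%E ->
  (f ((1 - s) *: x + s *: y)%R <= ((1 - s) * r + s * r')%:E)%E.
Proof.
move=> s01 fx fy; apply: (le_trans (f_convex x y s01)).
rewrite (EFinD ((1 - s) * r)) !EFinM; case/andP: s01 => s0 s1.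
by apply: leeD; apply: lee_wpmul2l => //; rewrite lee_fin ?subr_ge0.
Qed.

Lemma subdifferential_le p u y r : df p u -> (f y <= r%:E)%E ->
  fine (f p) + dot u (y - p) <= r.
Proof.
move=> pu fy; have := le_trans (pu y) fy.
have := f_proper.1 p; case: (f p) => [a|//|//] _ /=.
by rewrite -EFinD lee_fin.
Qed.

Lemma subdifferential_dom p u y r : df p u -> (f y <= r%:E)%E ->
  f p = (fine (f p))%:E.
Proof.
move=> pu fy; have := le_trans (pu y) fy.
by have := f_proper.1 p; case: (f p) => [a|//|//].
Qed.

Context (m0 : R) (f_bounded : forall y r, (f y <= r%:E)%E -> m0 <= r).

(** The minimized function ranges over the epigraph of [f], to keep its values
    real. *)
Let penalized c x (p : H * R) := p.2 + c * `|x - p.1| ^+ 2.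
Let penalized_values c x :=
  [set penalized c x p | p in [set p | (f p.1 <= p.2%:E)%E]].

Let has_inf_penalized c x : 0 < c -> has_inf (penalized_values c x).
Proof.
move=> c0; split.
  have [z fz] := f_proper.2.
  exists (penalized c x (z, fine (f z))); exists (z, fine (f z)) => //=.
  by rewrite fineK// fin_numE f_proper.1 lt_eqF.
exists m0 => _ [[z r] /= fz <-]; rewrite /penalized /=.
by rewrite (le_trans (f_bounded fz))// lerDl mulr_ge0 ?sqr_ge0// ltW.
Qed.

Let inf_penalized_le c x z r : 0 < c -> (f z <= r%:E)%E ->
  inf (penalized_values c x) <= r + c * `|x - z| ^+ 2.
Proof.
move=> c0 fz; apply: ge_inf; first exact: (has_inf_penalized x c0).2.
by exists (z, r).
Qed.

(** Parallelogram law: strong convexity of the penalty makes minimizing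
    sequences Cauchy. *)
Let midpoint c x (z w : H) r r' : 0 < c ->
  (f z <= r%:E)%E -> (f w <= r'%:E)%E ->
  inf (penalized_values c x) + c / 4 * `|z - w| ^+ 2 <=
    ((r + c * `|x - z| ^+ 2) + (r' + c * `|x - w| ^+ 2)) / 2.
Proof.
move=> c0 fz fw.
have h : 0 <= (2^-1 : R) <= 1 by apply/andP; split; lra.
have /inf_penalized_le := convex_epigraph h fz fw => /(_ c x c0).
rewrite !hdot !dotE !(dotC dot z x) !(dotC dot w x) (dotC dot w z).
lra.
Qed.

Let minimizer c x : 0 < c ->
  exists p r, (f p <= r%:E)%E /\
    r + c * `|x - p| ^+ 2 <= inf (penalized_values c x).
Proof.
move=> c0; set m := inf _.
have /choice[zr zrP] : forall n : nat, exists p : H * R,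
    (f p.1 <= p.2%:E)%E /\ p.2 + c * `|x - p.1| ^+ 2 <= m + n.+1%:R^-1.
  move=> n; have [||_ [p /= fp <-] /ltW pe] :=
    @inf_adherent R (penalized_values c x) n.+1%:R^-1.
  - by rewrite invr_gt0.
  - exact: has_inf_penalized.
  by exists p.
have zz (N n : nat) : (N <= n)%N ->
    c / 4 * `|(zr N).1 - (zr n).1| ^+ 2 <= N.+1%:R^-1.
  move=> Nn; have [fN mN] := zrP N; have [fn mn] := zrP n.
  have := midpoint x c0 fN fn; rewrite -/m.
  have : n.+1%:R^-1 <= N.+1%:R^-1 :> R by rewrite lef_pV2 ?posrE// ler_nat.
  move: mN mn; rewrite -/m; move: (N.+1%:R^-1) (n.+1%:R^-1) => a b; lra.
have /cvg_ex[p zp] : cvgn (fun n => (zr n).1).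
  apply/cauchy_cvgP/cauchy_exP => e e0.
  have ce : 0 < c / 4 * e ^+ 2 by rewrite mulr_gt0 ?exprn_gt0// divr_gt0.
  have [N _ /(_ N (leqnn N)) /= hN] := near_infty_natSinv_lt (PosNum ce).
  exists (zr N).1; exists N => // n /= /zz h.
  rewrite -ball_normE /=; have := le_lt_trans h hN.
  by rewrite ltr_pM2l ?divr_gt0// ltr_pXn2r ?nnegrE ?(ltW e0).
(* The second coordinates [(zr n).2] need not converge, but these larger
   ordinates, forced by near-minimality, do. *)
pose r n := m + n.+1%:R^-1 - c * `|x - (zr n).1| ^+ 2.
have rp : r n @[n --> \oo] --> m + 0 - c * `|x - p| ^+ 2.
  apply: cvgB; first by apply: cvgD; [exact: cvg_cst|exact: cvg_harmonic].
  rewrite expr2; apply: cvgMr; apply: cvgM; apply: cvg_norm;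
    by apply: cvgB => //; exact: cvg_cst.
exists p, (m + 0 - c * `|x - p| ^+ 2); split; last by rewrite addr0 subrK.
apply: (@closed_cvg _ _ \oo _ (fun n => ((zr n).1, r n)) _ f_closed _
  (p, m + 0 - c * `|x - p| ^+ 2)); last exact: (cvg_pair zp rp).
apply: nearW => n /=; have [fn mn] := zrP n.
by rewrite (le_trans fn)// lee_fin /r lerBrDr.
Qed.

(** First-order optimality: comparing the minimizer [p] with
    [(1 - s) p + s y] and letting [s] tend to 0 gives the subgradient
    inequality at [y]. *)
Lemma proximal_point mu x : 0 < mu -> exists p u, df p u /\ p + mu *: u = x.
Proof.
move=> mu0; pose c := (2 * mu)^-1.
have c0 : 0 < c by rewrite invr_gt0 mulr_gt0.
have [p [r [fp pm]]] := minimizer x c0.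
exists p, (mu^-1 *: (x - p)); split; last first.
  by rewrite scalerA divff ?gt_eqF// scale1r addrC subrK.
move=> y; have [->|yfin] := eqVneq (f y) +oo%E; first by rewrite leey.
have fy : f y = (fine (f y))%:E by rewrite fineK// fin_numE f_proper.1.
have fpE := fine_proper fp.
rewrite fpE fy -EFinD lee_fin -subr_le0.
have ap : fine (f p) <= r by rewrite -lee_fin -fpE.
apply: (@le0_of_le_small _ _ (c * `|y - p| ^+ 2)).
  by rewrite mulr_ge0 ?sqr_ge0// ltW.
move=> s /andP[s0 s1].
have s01 : 0 <= s <= 1 by rewrite s1 ltW.
have h1 : (f p <= (fine (f p))%:E)%E by rewrite -fpE.
have h2 : (f y <= (fine (f y))%:E)%E by rewrite -fy.
have /(inf_penalized_le x c0) := convex_epigraph s01 h1 h2.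
move=> /(le_trans pm) /(le_trans (lerD ap (lexx _))) h3.
have -> : mu^-1 = 2 * c by rewrite /c invfM mulrA divff ?mul1r.
rewrite -(ler_pM2l s0); move: h3.
rewrite !hdot !dotE !(dotC dot p x) !(dotC dot y x) (dotC dot p y).
lra.
Qed.

End Prox.

(** * The Moreau envelope *)

Section MoreauEnvelope.
Context {R : realType} {H : completeNormedModType R}.
Context (dot : {dot H for (@idfun R)}) (hdot : induces_norm dot).
Context (f : H -> \bar R) (f_proper : proper_fun f) (f_closed : closed_fun f)
  (f_convex : convex_fun f).
Context (m0 : R) (f_bounded : forall y r, (f y <= r%:E)%E -> m0 <= r).

Local Notation df := (subdifferential dot f).

Lemma resolvent_subdifferential mu x : 0 < mu ->
  df (resolvent mu df x) (mu^-1 *: (x - resolvent mu df x)).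
Proof.
move=> mu0.
have [p [u [pu xE]]] :=
  proximal_point hdot f_proper f_closed f_convex f_bounded x mu0.
have : exists p', op_inv (id_add_scale mu df) x p' by exists p, u.
move=> /(@xgetPex _ 0).
rewrite -/(resolvent mu df x) => -[w /[swap] xw].
move: (resolvent _ _ _) xw => q xw.
by rewrite -xw addrAC subrr add0r scalerA mulVf ?gt_eqF// scale1r.
Qed.

Lemma resolvent_dom mu x : 0 < mu ->
  f (resolvent mu df x) = (fine (f (resolvent mu df x)))%:E.
Proof.
move=> /(resolvent_subdifferential x) h; have [z fz] := f_proper.2.
apply: (subdifferential_dom f_proper (y := z) (r := fine (f z)) h).
by rewrite fineK// fin_numE f_proper.1 lt_eqF.
Qed.

Definition envelope mu x : R :=
  fine (f (resolvent mu df x)) + `|x - resolvent mu df x| ^+ 2 / (2 * mu).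

(** Together with the definition, this says that [envelope mu x] is the minimum
    of [f z + |x - z|^2 / (2 mu)] over [z], reached at the resolvent. *)
Lemma envelope_le mu x z r : 0 < mu -> (f z <= r%:E)%E ->
  envelope mu x <= r + `|x - z| ^+ 2 / (2 * mu).
Proof.
move=> mu0 fz; have h := resolvent_subdifferential x mu0.
have := subdifferential_le f_proper h fz; rewrite /envelope.
move: (resolvent mu df x) h => p _.
rewrite invfM !(hdot) !dotE !(dotC dot p x) !(dotC dot z x) (dotC dot p z).
set a := mu^-1.
have a0 : 0 < a by rewrite invr_gt0.
have := mulr_ge0 (ltW a0) (dot_ge0 hdot (z - p)).
rewrite !dotE (dotC dot p z); lra.
Qed.

Lemma envelope_le_self mu x r : 0 < mu -> (f x <= r%:E)%E -> envelope mu x <= r.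
Proof.
move=> mu0 /(envelope_le x mu0) h; apply: (le_trans h).
by rewrite subrr normr0 expr0n mul0r addr0.
Qed.

(** The envelope of an affine function of slope [w] is the same function lowered
    by [mu |w|^2 / 2]: minimize [dot w (z - x) + |x - z|^2 / (2 mu)] by
    completing the square. *)
Lemma envelope_ge_affine mu x y w : 0 < mu -> df y w ->
  fine (f y) + dot w (x - y) - mu / 2 * `|w| ^+ 2 <= envelope mu x.
Proof.
move=> mu0 yw; have fp := resolvent_dom x mu0.
have := subdifferential_le f_proper yw _ (r := fine (f (resolvent mu df x))).
move=> /(_ (resolvent mu df x)); rewrite -fp lexx => /(_ isT).
rewrite /envelope; move: (resolvent mu df x) => p h.
have : 0 <= dot (x - p - mu *: w) (x - p - mu *: w) / (2 * mu).
  by rewrite divr_ge0 ?dot_ge0// mulr_ge0 ?ltW.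
rewrite invfM; set a := mu^-1.
have am : mu * a = 1 by rewrite /a divff ?gt_eqF.
rewrite -(subr_ge0 _ (fine (f p) + _)) => h'.
have -> : fine (f p) + `|x - p| ^+ 2 * (2^-1 * a) -
    (fine (f y) + dot w (x - y) - mu / 2 * `|w| ^+ 2) =
  dot (x - p - mu *: w) (x - p - mu *: w) * (2^-1 * a) +
  (fine (f p) - (fine (f y) + dot w (p - y))).
  rewrite !hdot !dotE !(dotC dot p x) !(dotC dot w x) !(dotC dot w p).
  by field : am.
by rewrite addr_ge0// subr_ge0.
Qed.

(** The affine minorant given by the subgradient at the proximal point of [x]
    touches the envelope at [x]: there the inequality of [envelope_ge_affine] is
    an equality. *)
Lemma envelope_subgradient mu x x' : 0 < mu ->
  envelope mu x + dot (mu^-1 *: (x - resolvent mu df x)) (x' - x)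
  <= envelope mu x'.
Proof.
move=> mu0; have h := resolvent_subdifferential x mu0.
have := envelope_ge_affine x' mu0 h; apply: le_trans.
rewrite /envelope; move: (resolvent mu df x) => p.
rewrite invfM; set a := mu^-1.
have am : mu * a = 1 by rewrite /a divff ?gt_eqF.
have -> : mu / 2 * `|a *: (x - p)| ^+ 2 = a * `|x - p| ^+ 2 / 2.
  by rewrite !hdot !dotE; field : am.
rewrite !hdot !dotE !(dotC dot p x) ?(dotC dot x' x) !(dotC dot p x'); lra.
Qed.

(** The lower bound is [envelope_subgradient]; for the upper one, test
    [envelope mu x'] at the proximal point of [x]. *)
Lemma envelope_expansion mu x x' : 0 < mu ->
  `|envelope mu x' - envelope mu x
    - dot (mu^-1 *: (x - resolvent mu df x)) (x' - x)|
  <= (2 * mu)^-1 * `|x' - x| ^+ 2.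
Proof.
move=> mu0; have fp := resolvent_dom x mu0.
rewrite ger0_norm; last by rewrite -addrA -opprD subr_ge0 envelope_subgradient.
have := envelope_le x' mu0 (_ : (f (resolvent mu df x) <= _)%E).
rewrite {1}fp => /(_ _ (lexx _)).
rewrite {3}/envelope; move: (resolvent mu df x) => p.
rewrite invfM; set a := mu^-1.
rewrite !hdot !dotE !(dotC dot p x) !(dotC dot x' x) !(dotC dot p x').
lra.
Qed.

End MoreauEnvelope.

(** * Real functions differentiable on the half-line *)

Section HalfLineCalculus.
Context {R : realType}.
Implicit Types (phi D : R -> R) (t d e : R).

(** [has_derivative_ge0] for functions with values in [R]. *)
Definition real_derivative_ge0 phi t d : Prop :=
  (s - t)^-1 * (phi s - phi t) @[s --> within `[0, +oo[ t^'] --> d.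

Lemma real_derivative_ge0_is_derive phi t d : 0 < t ->
  real_derivative_ge0 phi t d -> is_derive t 1 phi d.
Proof.
move=> t0 phit.
suff h : h^-1 *: (phi (h *: 1 + t) - phi t) @[h --> 0^'] --> d.
  by apply: DeriveDef; [apply/cvg_ex; exists d|exact/cvg_lim].
apply/cvgrPdist_lt => e e0; move/cvgrPdist_lt : phit => /(_ e e0).
rewrite /near/= /within/= /dnbhs /within/= => /nbhs_ballP[r /= r0 tr].
apply/nbhs_ballP; exists (Order.min r t); first by rewrite /= lt_min r0.
move=> h; rewrite /ball/= sub0r normrN lt_min => /andP[hr ht] h0.
have := tr (h + t); rewrite /ball/= opprD addrCA subrr addr0 normrN => /(_ hr).
rewrite addrK -subr_eq0 addrK => /(_ h0).
rewrite in_itv/= andbT -lerBlDr sub0r => /(_ _).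
rewrite /GRing.scale/= mulr1; apply.
by move: ht; rewrite ltr_norml => /andP[/ltW].
Qed.

Lemma increment_cvg0 t : (s - t) @[s --> within `[0, +oo[ t^'] --> 0.
Proof.
apply/cvgrPdist_lt => e e0; rewrite /near/= /within/= /dnbhs /within/=.
apply/nbhs_ballP; exists e => // s /= ts _ _.
by rewrite sub0r opprB.
Qed.

Lemma real_derivative_ge0_continuous phi t d :
  real_derivative_ge0 phi t d ->
  phi s @[s --> within `[0, +oo[ (nbhs t)] --> phi t.
Proof.
move=> phit.
have phit0 : (s - t) * ((s - t)^-1 * (phi s - phi t))
    @[s --> within `[0, +oo[ t^'] --> (0 : R).
  rewrite -[X in _ --> X](mul0r d).
  by apply: cvgM => //; exact: increment_cvg0.
apply/cvgrPdist_lt => e e0; move/cvgrPdist_lt : phit0 => /(_ e e0).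
rewrite /near/= /within/= /dnbhs /within/=.
move=> /nbhs_ballP[r r0 tr]; apply/nbhs_ballP; exists r => // s rs /= s0.
have [->|st] := eqVneq s t; first by rewrite subrr normr0.
have := tr s rs st s0.
by rewrite mulVKf ?subr_eq0// sub0r normrN distrC.
Qed.

Lemma within_segment_continuous (psi : R -> R) (a b : R) : 0 <= a ->
  (forall s, a <= s -> s <= b ->
    psi u @[u --> within `[0, +oo[ (nbhs s)] --> psi s) ->
  {within `[a, b], continuous psi}.
Proof.
move=> a0 psis; apply/subspace_continuousP => s /=.
rewrite in_itv/= => /andP[sa sb].
apply: cvg_trans (psis s sa sb); apply: cvg_app; apply: within_subset => u /=.
by rewrite !in_itv/= andbT => /andP[/(le_trans a0)].
Qed.

Lemma real_derivative_ge0_nonincreasing phi D :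
  (forall s, 0 <= s -> real_derivative_ge0 phi s (D s)) ->
  (forall s, 0 <= s -> D s <= 0) ->
  forall a b, 0 <= a -> a <= b -> phi b <= phi a.
Proof.
move=> phiD D0 a b a0 ab.
have [|||c cab phiE] := @MVT_segment _ phi D a b => //.
- move=> s; rewrite in_itv/= => /andP[sa _].
  have s0 := le_lt_trans a0 sa.
  by apply: real_derivative_ge0_is_derive => //; exact/phiD/ltW.
- apply: within_segment_continuous => // s sa _.
  exact: (real_derivative_ge0_continuous (phiD s (le_trans a0 sa))).
move: cab; rewrite in_itv/= => /andP[ca _].
rewrite -subr_le0 phiE mulr_le0_ge0 ?subr_ge0//.
exact/D0/(le_trans a0).
Qed.

(** While [phi] is positive, [(phi^(-1/2))' = - phi' phi^(-3/2) / 2 >= k]; the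
    mean value theorem bounds [phi t] from above.  Once [phi] is nonpositive
    there is nothing to prove. *)
Lemma power_decay phi D k delta t : 0 <= k -> 0 < delta -> 0 <= t ->
  (forall s, 0 <= s -> real_derivative_ge0 phi s (D s)) ->
  (forall s, 0 <= s -> D s <= 0) ->
  (forall s, 0 <= s -> 0 < phi s ->
    D s <= - (2 * k * (phi s * Num.sqrt (phi s)))) ->
  phi 0 <= delta ->
  phi t <= delta / (1 + t * k * Num.sqrt delta) ^+ 2.
Proof.
move=> k0 delta0 t0 phiD D0 Dk phi0.
have den0 : 0 < 1 + t * k * Num.sqrt delta.
  by rewrite ltr_pwDl// !mulr_ge0// sqrtr_ge0.
have [phit|phit] := leP (phi t) 0.
  by rewrite (le_trans phit)// divr_ge0 ?exprn_ge0 ?ltW.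
have mono := real_derivative_ge0_nonincreasing phiD D0.
have pos s : 0 <= s -> s <= t -> 0 < phi s.
  by move=> s0 st; rewrite (lt_le_trans phit)// mono.
pose g s := (Num.sqrt (phi s))^-1.
have [|||c ct gE] := @MVT_segment _ g
    (fun s => - Num.sqrt (phi s) ^- 2 * ((2 * Num.sqrt (phi s))^-1 * D s)) 0 t => //.
- move=> s; rewrite in_itv/= => /andP[s0 st].
  have ps := pos s (ltW s0) (ltW st).
  apply: (@is_deriveV _ (Num.sqrt \o phi)); first by rewrite sqrtr_eq0 -ltNge.
  apply: is_derive1_comp; first exact: is_derive1_sqrt.
  by apply: real_derivative_ge0_is_derive => //; exact/phiD/ltW.
- apply: within_segment_continuous => // s s0 st; apply: cvgV.
    by rewrite sqrtr_eq0 -ltNge pos.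
  apply: continuous_cvg; first exact: sqrt_continuous.
  exact: (real_derivative_ge0_continuous (phiD s s0)).
move: ct; rewrite in_itv/= => /andP[c0 ct].
have pc := pos c c0 ct.
have hc : k <= - Num.sqrt (phi c) ^- 2 * ((2 * Num.sqrt (phi c))^-1 * D c).
  have := Dk c c0 pc; have := sqr_sqrtr (ltW pc).
  have : 0 < Num.sqrt (phi c) by rewrite sqrtr_gt0.
  move: (Num.sqrt (phi c)) => q q0 <- h.
  have -> : - q ^- 2 * ((2 * q)^-1 * D c) = - D c / (2 * q ^+ 3).
    by field; rewrite gt_eqF.
  rewrite ler_pdivlMr ?mulr_gt0 ?exprn_gt0//; lra.
have hg : t * k + (Num.sqrt delta)^-1 <= g t.
  have : (Num.sqrt delta)^-1 <= g 0.
    by rewrite /g lef_pV2 ?posrE ?sqrtr_gt0 ?pos// ler_wsqrtr.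
  have : t * k <= g t - g 0 by rewrite gE subr0 mulrC ler_wpM2r.
  lra.
have sd : 0 < Num.sqrt delta by rewrite sqrtr_gt0.
have st : 0 < Num.sqrt (phi t) by rewrite sqrtr_gt0.
rewrite -{1}(sqr_sqrtr (ltW phit)) -{1}(sqr_sqrtr (ltW delta0)) -expr_div_n.
rewrite lerXn2r ?nnegrE ?divr_ge0 ?sqrtr_ge0 ?(ltW den0)//.
rewrite ler_pdivlMr//; move: hg; rewrite /g.
move: (Num.sqrt delta) (Num.sqrt (phi t)) sd st => q p q0 p0.
rewrite -(ler_pM2r (mulr_gt0 q0 p0)).
have -> : (t * k + q^-1) * (q * p) = p * (1 + t * k * q) by field; rewrite gt_eqF.
by have -> : p^-1 * (q * p) = q by field; rewrite gt_eqF.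
Qed.

End HalfLineCalculus.

Section ChainRule.
Context {R : realType} {H : completeNormedModType R}.
Context (dot : {dot H for (@idfun R)}) (hdot : induces_norm dot).

(** Chain rule for an [E] with a second-order expansion at [x t]; it applies to
    the squared distance to a point and to the Moreau envelope. *)
Lemma has_derivative_ge0_comp (E : H -> R) (x : R -> H) t xi v C :
  (forall p, `|E p - E (x t) - dot v (p - x t)| <= C * `|p - x t| ^+ 2) ->
  has_derivative_ge0 x t xi ->
  real_derivative_ge0 (E \o x) t (dot v xi).
Proof.
move=> Ex xt; apply/subr_cvg0/norm_cvg0P.
pose q s := (s - t)^-1 *: (x s - x t).
apply: (@squeeze_cvgr _ _ _ _ (fun=> 0)
   (fun s => `|v| * `|q s - xi| + C * `|s - t| * `|q s| ^+ 2)).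
- apply: nearW => s; rewrite normr_ge0/=.
  (* At [s = t] both quotients are 0, since [0^-1 = 0]. *)
  have [->|st] := eqVneq s t.
    rewrite /q !subrr invr0 mul0r scale0r !sub0r !normrN !normr0 expr0n !mulr0.
    by rewrite addr0 (cauchy_schwarz hdot).
  have st' : s - t != 0 by rewrite subr_eq0.
  have := Ex (x s).
  have -> : x s - x t = (s - t) *: q s by rewrite scalerA divff// scale1r.
  set r := E (x s) - E (x t) - _ => hr.
  have -> : (s - t)^-1 * (E (x s) - E (x t)) - dot v xi =
      dot v (q s - xi) + (s - t)^-1 * r.
    by rewrite /r !dotE; field.
  apply: (le_trans (ler_normD _ _)); apply: lerD; first exact: cauchy_schwarz.
  rewrite normrM normfV ler_pdivrMl ?normr_gt0//; apply: (le_trans hr).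
  by rewrite normrZ exprMn; lra.
- exact: cvg_cst.
have st0 := increment_cvg0 t.
have {2}-> : 0 = `|v| * 0 + C * 0 * `|xi| ^+ 2 by rewrite !mulr0 mul0r addr0.
apply: cvgD.
  apply: cvgMr; apply/norm_cvg0P; apply/subr_cvg0; exact: xt.
apply: cvgM; first by apply: cvgMr; apply/norm_cvg0P.
by rewrite expr2; apply: cvgM; apply: cvg_norm; exact: xt.
Qed.
End ChainRule.

(** * Scalar inequalities *)

(** Convexity of [F g := g + kappa g^(3/2)] gives
    [beta >= F gamma >= F beta + F'(beta) (gamma - beta)], that is
    [beta - gamma >= 2 kappa beta^(3/2) / (2 + 3 kappa sqrt beta)].  In the
    proof [g], [b], [d] are the square roots of [gamma], [beta], [delta]. *)
Lemma rate_inequality (R : realType) (kappa gamma beta delta : R) :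
  0 <= kappa -> 0 <= gamma ->
  gamma + kappa * (gamma * Num.sqrt gamma) <= beta -> beta <= delta ->
  gamma - beta <= - (2 * (kappa / (2 + 3 * kappa * Num.sqrt delta))
                       * (beta * Num.sqrt beta)).
Proof.
move=> k0 g0 gb bd.
have gb0 : gamma <= beta.
  by apply: le_trans gb; rewrite lerDl !mulr_ge0// sqrtr_ge0.
have b0 := le_trans g0 gb0.
have : Num.sqrt gamma <= Num.sqrt beta by rewrite ler_wsqrtr.
have : Num.sqrt beta <= Num.sqrt delta by rewrite ler_wsqrtr.
have := sqrtr_ge0 gamma; have := sqr_sqrtr g0; have := sqr_sqrtr b0; move: gb.
move: (Num.sqrt gamma) (Num.sqrt beta) (Num.sqrt delta) => g b d.
move=> h bE gE g' bd' gb'; rewrite -bE -gE in h *.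
have -> : 2 * (kappa / (2 + 3 * kappa * d)) * (b ^+ 2 * b) =
    2 * kappa * b ^+ 3 / (2 + 3 * kappa * d) by ring.
rewrite lerNr opprB ler_pdivrMr; last first.
  by rewrite ltr_wpDr// !mulr_ge0//; lra.
(* [kappa * (b^3 - 3 b g^2 + 2 g^3)] is twice the error at [gamma] of the
   tangent to [F] at [beta]; [h2] pays for replacing [b] by [d] in the slope. *)
have h1 : 0 <= kappa * ((b - g) ^+ 2 * (b + 2 * g)).
  by rewrite mulr_ge0// mulr_ge0 ?sqr_ge0//; lra.
have h2 : 0 <= kappa * (d - b) * (b ^+ 2 - g ^+ 2).
  rewrite mulr_ge0//; first by rewrite mulr_ge0// subr_ge0.
  by rewrite subr_ge0 lerXn2r// nnegrE; lra.
lra.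
Qed.

(** Here [l] is the step, [n] the norm of the subgradient and [gamma] the value
    gap after the step.  Since [kappa gamma^(3/2) <= l n^2] follows from
    [l^2 n = theta] and [gamma <= n d], the point is that [theta <= l d], which
    makes [mu / 2] at most the fraction [mu d / (2 theta)] of [l]. *)
Lemma step_inequality (R : realType) (l n d theta mu gamma : R) :
  0 < l -> 0 < d -> 0 < theta -> 0 <= mu -> mu * d <= 2 * theta ->
  l ^+ 2 * n = theta -> l * n <= d -> 0 <= gamma -> gamma <= n * d ->
  (1 - mu * d / (2 * theta)) * Num.sqrt (theta / d ^+ 3)
    * (gamma * Num.sqrt gamma) <= l * n ^+ 2 - mu / 2 * n ^+ 2.
Proof.
move=> l0 d0 theta0 mu0 mud ln lnd g0 gn.
have n0 : 0 < n by move: theta0; rewrite -ln pmulr_rgt0// exprn_gt0.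
have e0 : 0 <= 1 - mu * d / (2 * theta).
  by rewrite subr_ge0 ler_pdivrMr ?mul1r// mulr_gt0.
have hk : Num.sqrt (theta / d ^+ 3) * (gamma * Num.sqrt gamma) <= l * n ^+ 2.
  have h : gamma * Num.sqrt gamma <= n * d * Num.sqrt (n * d).
    by rewrite ler_pM ?sqrtr_ge0// ler_wsqrtr.
  apply: (le_trans (ler_wpM2l (sqrtr_ge0 _) h)).
  rewrite mulrCA -sqrtrM; last by rewrite divr_ge0 ?exprn_ge0 ?ltW.
  have -> : theta / d ^+ 3 * (n * d) = (l * n / d) ^+ 2.
    by rewrite -ln; field; rewrite gt_eqF.
  rewrite sqrtr_sqr ger0_norm; last by rewrite divr_ge0 ?mulr_ge0 ?ltW.
  by have -> : n * d * (l * n / d) = l * n ^+ 2 by field; rewrite gt_eqF.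
rewrite -mulrA; apply: (le_trans (ler_wpM2l e0 hk)).
have -> : (1 - mu * d / (2 * theta)) * (l * n ^+ 2) =
    l * n ^+ 2 - mu / 2 * n ^+ 2 * (d * l / theta) by field; rewrite gt_eqF.
rewrite lerD2l lerN2; apply: ler_peMr.
  by rewrite mulr_ge0 ?sqr_ge0// divr_ge0.
rewrite ler_pdivlMr// mul1r -ln expr2 -mulrA mulrC.
by rewrite ler_pM2r.
Qed.

(** * The trajectory *)

Section Trajectory.
Context {R : realType} {H : completeNormedModType R}.
Context (dot : {dot H for (@idfun R)}) (hdot : induces_norm dot).
Context (f : H -> \bar R) (f_proper : proper_fun f) (f_closed : closed_fun f)
  (f_convex : convex_fun f).
Context (zbar : H) (zbar_min : argmin f zbar).

Local Notation df := (subdifferential dot f).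
Local Notation fbar := (fine (f zbar)).
Local Notation env := (envelope dot f).

Lemma argmin_dom : f zbar = fbar%:E.
Proof.
have [z fz] := f_proper.2.
rewrite fineK// fin_numE f_proper.1 lt_eqF//.
exact: (le_lt_trans (zbar_min z)).
Qed.

Lemma argmin_bound y r : (f y <= r%:E)%E -> fbar <= r.
Proof. by move=> /(le_trans (zbar_min y)); rewrite argmin_dom lee_fin. Qed.

Let resolvent_df :=
  resolvent_subdifferential hdot f_proper f_closed f_convex argmin_bound.

(** Monotonicity of the subdifferential between the resolvent and [zbar], where
    0 is a subgradient. *)
Lemma resolvent_obtuse l x : 0 < l ->
  0 <= dot (x - resolvent l df x) (resolvent l df x - zbar).
Proof.
move=> l0; have yv := resolvent_df x l0.
have fz : (f zbar <= fbar%:E)%E by rewrite -argmin_dom.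
have := subdifferential_le f_proper yv fz.
have fy := subdifferential_dom f_proper yv fz.
have : fbar <= fine (f (resolvent l df x)) by apply: argmin_bound; rewrite -fy.
move: (resolvent l df x) => y h1 h2.
have : dot (l^-1 *: (x - y)) (zbar - y) <= 0 by lra.
rewrite dotZl pmulr_rle0 ?invr_gt0// -(opprB y zbar) dotNr; lra.
Qed.

Lemma resolvent_step_le l x : 0 < l ->
  `|x - resolvent l df x| <= `|x - zbar| /\
  `|resolvent l df x - zbar| <= `|x - zbar|.
Proof.
move=> /(resolvent_obtuse x); move: (resolvent _ _ _) => y h.
have E : `|x - zbar| ^+ 2 =
    `|x - y| ^+ 2 + 2 * dot (x - y) (y - zbar) + `|y - zbar| ^+ 2.
  rewrite !hdot !dotE !(dotC dot zbar x) !(dotC dot y x) !(dotC dot zbar y); ring.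
have := sqr_ge0 `|x - y|; have := sqr_ge0 `|y - zbar| => h1 h2.
by split; rewrite -ler_sqr ?nnegrE// E; lra.
Qed.

(** The decrease of [f] achieved by one resolvent step, measured with the
    envelope at the starting point and compared with the value gap that
    remains. *)
Lemma envelope_gap l theta d mu x : 0 < l -> 0 < theta -> 0 < mu ->
  0 < d -> mu * d <= 2 * theta -> `|x - zbar| <= d ->
  l * `|resolvent l df x - x| = theta ->
  let gamma := fine (f (resolvent l df x)) - fbar in
  0 <= gamma /\
  gamma + (1 - mu * d / (2 * theta)) * Num.sqrt (theta / d ^+ 3)
            * (gamma * Num.sqrt gamma) <= env mu x - fbar.
Proof.
move=> l0 theta0 mu0 d0 mud xd ltheta.
have yv := resolvent_df x l0.
have [xy yz] := resolvent_step_le x l0.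
have fz : (f zbar <= fbar%:E)%E by rewrite -argmin_dom.
have fy := subdifferential_dom f_proper yv fz.
have := subdifferential_le f_proper yv fz.
have := envelope_ge_affine hdot f_proper f_closed f_convex argmin_bound x mu0 yv.
have g0 : fbar <= fine (f (resolvent l df x)) by apply: argmin_bound; rewrite -fy.
rewrite distrC in ltheta.
move: (resolvent l df x) yv fy xy yz g0 ltheta => y yv fy xy yz g0 ltheta.
set n := `|l^-1 *: (x - y)| => henv hsub gamma.
have nE : `|x - y| = l * n.
  by rewrite /n normrZ gtr0_norm ?invr_gt0// mulrA divff ?mul1r// gt_eqF.
have dE : dot (l^-1 *: (x - y)) (x - y) = l * n ^+ 2.
  by rewrite dotZl -hdot nE; field; rewrite gt_eqF.
have gn : gamma <= n * d.
  have h : dot (l^-1 *: (x - y)) (y - zbar) <= n * d.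
    apply: (le_trans (dot_le_norm hdot _ _)).
    by rewrite ler_wpM2l ?normr_ge0// (le_trans yz).
  move: hsub h; rewrite -(opprB y zbar) dotNr /gamma; lra.
have gamma0 : 0 <= gamma by rewrite subr_ge0.
split => //.
have hs := @step_inequality R l n d theta mu gamma l0 d0 theta0 (ltW mu0) mud.
have {hs} hs := hs _ _ gamma0 gn.
rewrite addrC -lerBrDr.
apply: (le_trans (hs _ _)).
- by rewrite -ltheta nE; ring.
- by rewrite -nE (le_trans xy).
by move: henv; rewrite dE /gamma; lra.
Qed.

Context (x : R -> H) (lam : R -> R) (theta : R) (theta_gt0 : 0 < theta).
Context (x0 : H).
Context (hsol : global_solution df theta x0 x lam).

Let velocity s := resolvent (lam s) df (x s) - x s.

Lemma solution_derivative s : 0 <= s -> has_derivative_ge0 x s (velocity s).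
Proof.
have [[xdot xdotP] _] := hsol => /xdotP[xs eq0 _ _].
by rewrite /velocity -(subr0_eq eq0) addrK.
Qed.

(** [(|x - zbar|^2)' = 2 dot (x - zbar) (y - x)] is nonpositive by
    [resolvent_obtuse]. *)
Lemma dist_argmin_nonincreasing s : 0 <= s -> `|x s - zbar| <= `|x0 - zbar|.
Proof.
move=> s0; have [[xdot xdotP] <-] := hsol.
rewrite -ler_sqr ?nnegrE//.
apply: (@real_derivative_ge0_nonincreasing R ((fun p => `|p - zbar| ^+ 2) \o x)
  (fun s => dot (2 *: (x s - zbar)) (velocity s))) => // u u0.
  apply: (@has_derivative_ge0_comp R H dot hdot _ _ _ _ _ 1);
    last exact: solution_derivative.
  move=> p /=; rewrite mul1r.
  have -> : `|p - zbar| ^+ 2 - `|x u - zbar| ^+ 2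
      - dot (2 *: (x u - zbar)) (p - x u) = `|p - x u| ^+ 2.
    rewrite !hdot !dotE !(dotC dot zbar) !(dotC dot (x u) p); ring.
  by rewrite ger0_norm// sqr_ge0.
have [_ _ lu _] := xdotP u u0.
have := resolvent_obtuse (x u) lu.
have := sqr_ge0 `|x u - resolvent (lam u) df (x u)|.
rewrite /velocity; move: (resolvent _ _ _) => y.
rewrite !hdot !dotE !(dotC dot zbar) !(dotC dot y (x u)); lra.
Qed.

(** [power_decay] applied to [envelope mu \o x - min f].  Its derivative is at
    most [f y - envelope mu x], by the subgradient inequality for the envelope
    and [envelope mu y <= f y]. *)
Lemma envelope_decay mu d delta kappa t :
  0 < mu -> 0 < d -> mu * d <= 2 * theta -> `|x0 - zbar| <= d ->
  0 < delta -> (f x0 <= (fbar + delta)%:E)%E -> 0 <= t ->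
  kappa = (1 - mu * d / (2 * theta)) * Num.sqrt (theta / d ^+ 3) ->
  env mu (x t) - fbar <=
    delta / (1 + t * (kappa / (2 + 3 * kappa * Num.sqrt delta))
               * Num.sqrt delta) ^+ 2.
Proof.
move=> mu0 d0 mud x0d delta0 fx0 t0 kE; have [[xdot xdotP] xE] := hsol.
have k0 : 0 <= kappa.
  by rewrite kE mulr_ge0 ?sqrtr_ge0// subr_ge0 ler_pdivrMr ?mul1r// mulr_gt0.
pose phi := (fun p => env mu p - fbar) \o x.
pose D s := dot (mu^-1 *: (x s - resolvent mu df (x s))) (velocity s).
have phiD s : 0 <= s -> real_derivative_ge0 phi s (D s).
  move=> s0; apply: (@has_derivative_ge0_comp R H dot hdot _ _ _ _ _ (2 * mu)^-1);
    last exact: solution_derivative.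
  move=> p; rewrite opprB addrA subrK.
  exact: (envelope_expansion hdot f_proper f_closed f_convex argmin_bound).
have gap s : 0 <= s ->
    let gamma := fine (f (resolvent (lam s) df (x s))) - fbar in
    [/\ 0 <= gamma, gamma + kappa * (gamma * Num.sqrt gamma) <= phi s
      & D s <= gamma - phi s].
  move=> s0 gamma; have [_ _ ls lsE] := xdotP s s0.
  have xd := le_trans (dist_argmin_nonincreasing s0) x0d.
  have := envelope_gap ls theta_gt0 mu0 d0 mud xd lsE; rewrite -kE => -[g0 gphi].
  split => //.
  have yv := resolvent_df (x s) ls.
  have fz : (f zbar <= fbar%:E)%E by rewrite -argmin_dom.
  have fy := subdifferential_dom f_proper yv fz.
  have := envelope_subgradient hdot f_proper f_closed f_convex argmin_bound
    (x s) (resolvent (lam s) df (x s)) mu0.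
  have := envelope_le_self hdot f_proper f_closed f_convex argmin_bound mu0
    (_ : (f (resolvent (lam s) df (x s)) <= _)%E).
  rewrite {1}fy => /(_ _ (lexx _)).
  rewrite /D /gamma /phi /= -/(velocity s); lra.
have D0 s : 0 <= s -> D s <= 0.
  move=> /gap[g0 gphi /le_trans]; apply; rewrite subr_le0; apply: le_trans gphi.
  by rewrite lerDl !mulr_ge0// sqrtr_ge0.
have phi0 : phi 0 <= delta.
  rewrite /phi/= xE lerBlDl.
  exact: (envelope_le_self hdot f_proper f_closed f_convex argmin_bound).
apply: (power_decay _ delta0 t0 phiD D0 _ phi0).
  by rewrite divr_ge0// addr_ge0// !mulr_ge0// sqrtr_ge0.
move=> s s0 phis; have [g0 gphi Dg] := gap s s0.
apply: (le_trans Dg); apply: rate_inequality => //.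
apply: le_trans phi0.
exact: (real_derivative_ge0_nonincreasing phiD D0).
Qed.

(** Limit of [envelope_decay] as [mu] tends to 0 in the closed epigraph of [f]:
    the proximal points of [x t] converge to [x t] because
    [|x t - p|^2 <= 2 mu (envelope mu (x t) - min f) <= 2 mu delta]. *)
Lemma value_decay d delta kappa t :
  0 < d -> `|x0 - zbar| <= d ->
  0 < delta -> (f x0 <= (fbar + delta)%:E)%E -> 0 <= t ->
  kappa = Num.sqrt (theta / d ^+ 3) ->
  (f (x t) <= (fbar + delta / (1 + t * (kappa / (2 + 3 * kappa * Num.sqrt delta))
               * Num.sqrt delta) ^+ 2)%:E)%E.
Proof.
move=> d0 x0d delta0 fx0 t0 kE.
have k0 : 0 <= kappa by rewrite kE sqrtr_ge0.
(* With this choice [1 - mu n * d / (2 * theta)] is [1 - 1 / (2 (n + 1))],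
   which is at least [1 / 2] and tends to 1. *)
pose mu n := n.+1%:R^-1 * (theta / d).
pose B k := fbar + delta / (1 + t * (k / (2 + 3 * k * Num.sqrt delta))
               * Num.sqrt delta) ^+ 2.
have n0 n : 0 < n.+1%:R^-1 :> R by rewrite invr_gt0.
have mu0 n : 0 < mu n by rewrite mulr_gt0// divr_gt0.
have muE n : mu n * d / (2 * theta) = n.+1%:R^-1 / 2.
  by rewrite /mu; field; rewrite !gt_eqF// ltr0n.
have n1 n : n.+1%:R^-1 <= 1 :> R by rewrite invf_le1// ler1n.
have mud n : mu n * d <= 2 * theta.
  rewrite -[leRHS]mul1r -ler_pdivrMr ?mulr_gt0// muE.
  by move: (n.+1%:R^-1) (n1 n) => r; lra.
pose p n := resolvent (mu n) df (x t).
pose k n := (1 - n.+1%:R^-1 / 2) * kappa.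
have k_ge0 n : 0 <= k n.
  by rewrite mulr_ge0//; move: (n.+1%:R^-1) (n1 n) => r; lra.
have den_gt0 c : 0 <= c -> 0 < 2 + 3 * c * Num.sqrt delta.
  by move=> c0; rewrite ltr_pwDl// !mulr_ge0// sqrtr_ge0.
have den'_gt0 c : 0 <= c ->
    0 < 1 + t * (c / (2 + 3 * c * Num.sqrt delta)) * Num.sqrt delta.
  move=> c0; rewrite ltr_pwDl// !mulr_ge0 ?sqrtr_ge0// invr_ge0 ltW//.
  exact: den_gt0.
have env_le n : env (mu n) (x t) <= B (k n).
  rewrite -lerBlDl; apply: (envelope_decay (mu0 n) d0) => //.
  by rewrite muE -kE.
have B_le c : 0 <= c -> B c <= fbar + delta.
  move=> c0; rewrite lerD2l ler_pdivrMr ?exprn_gt0 ?den'_gt0//.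
  apply: ler_peMr; first exact: ltW.
  rewrite exprn_ege1// lerDl.
  by rewrite !mulr_ge0 ?sqrtr_ge0// invr_ge0 ltW// den_gt0.
have fp n : f (p n) = (fine (f (p n)))%:E.
  exact: (resolvent_dom hdot f_proper f_closed f_convex argmin_bound).
have fp_ge n : fbar <= fine (f (p n)) by apply: argmin_bound; rewrite -fp.
have px n : `|x t - p n| ^+ 2 <= 2 * delta * (theta / d) * n.+1%:R^-1.
  have : env (mu n) (x t) <= fbar + delta by rewrite (le_trans (env_le n))// B_le.
  rewrite /envelope -/(p n) => h.
  have : `|x t - p n| ^+ 2 / (2 * mu n) <= delta.
    by rewrite -(lerD2l fbar) (le_trans _ h)// lerD2r.
  rewrite ler_pdivrMr; last by rewrite mulr_gt0.
  move=> /le_trans; apply.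
  by rewrite le_eqVlt; apply/orP; left; apply/eqP; rewrite /mu; ring.
have harm : n.+1%:R^-1 @[n --> \oo] --> (0 : R) by exact: cvg_harmonic.
have p_cvg : p n @[n --> \oo] --> x t.
  apply/cvgrPdist_lt => e e0.
  pose c := 2 * delta * (theta / d).
  have c0 : 0 < c by rewrite /c mulr_gt0 ?divr_gt0 ?mulr_gt0.
  have ec : 0 < e ^+ 2 / c by rewrite divr_gt0 ?exprn_gt0.
  near=> n.
  rewrite -(ltr_pXn2r (_ : (0 < 2)%N)) ?nnegrE ?(ltW e0)//.
  apply: (le_lt_trans (px n)); rewrite -/c mulrC -ltr_pdivlMr//.
  near: n; exact: (near_infty_natSinv_lt (PosNum ec)).
have k_cvg : k n @[n --> \oo] --> kappa.
  have -> : kappa = (1 - 0 / 2) * kappa by rewrite mul0r subr0 mul1r.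
  by apply: cvgMl; apply: cvgB; [exact: cvg_cst|exact: cvgMl].
have B_cvg : B (k n) @[n --> \oo] --> B kappa.
  apply: cvgD; first exact: cvg_cst.
  apply: cvgMr; apply: cvgV; first by rewrite expf_neq0// gt_eqF// den'_gt0.
  rewrite !expr2.
  suff h : 1 + t * (k n / (2 + 3 * k n * Num.sqrt delta)) * Num.sqrt delta @[n --> \oo]
     --> 1 + t * (kappa / (2 + 3 * kappa * Num.sqrt delta)) * Num.sqrt delta.
    exact: cvgM.
  apply: cvgD; first exact: cvg_cst.
  apply: cvgMl; apply: cvgMr; apply: cvgM => //.
  apply: cvgV; first by rewrite gt_eqF// den_gt0.
  apply: cvgD; first exact: cvg_cst.
  by apply: cvgMl; apply: cvgMr.
apply: (@closed_cvg _ _ \oo _ (fun n => (p n, B (k n))) _ f_closed _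
  (x t, B kappa)); last exact: (cvg_pair p_cvg B_cvg).
apply: nearW => n /=; rewrite fp lee_fin (le_trans _ (env_le n))//.
by rewrite /envelope lerDl divr_ge0 ?sqr_ge0// mulr_ge0// ltW.
Unshelve. all: by end_near.
Qed.

End Trajectory.

Theorem theorem5p6 (R : realType) (H : completeNormedModType R)
    (dot : {dot H for (@idfun R)}) (hdot : induces_norm dot)
    (f : H -> \bar R)
    (f_proper : proper_fun f) (f_closed : closed_fun f)
    (f_convex : convex_fun f) (f_min : argmin f !=set0)
    (theta : R) (theta_gt0 : 0 < theta)
    (x0 : H) (x0_nmin : ~ argmin f x0) (x0_dom : (f x0 < +oo)%E)
    (x : R -> H) (lam : R -> R)
    (hsol : global_solution (subdifferential dot f) theta x0 x lam)
    (d0 : R) (hd0 : d0 = inf [set `|x0 - z| | z in argmin f])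
    (zbar : H) (zbar_min : argmin f zbar) (zbar_proj : `|x0 - zbar| = d0)
    (kappa : R) (hkappa : kappa = Num.sqrt (theta / d0 ^+ 3))
    (t : R) (ht : 0 <= t) :
  let delta0 : R := fine (f x0 - f zbar) in
  (f (x t) - f zbar <=
    (delta0 / (1 + t * kappa * Num.sqrt delta0
                   / (2 + 3 * kappa * Num.sqrt delta0)) ^+ 2)%:E)%E.
Proof.
have fz := argmin_dom f_proper zbar_min.
have fx0 : f x0 = (fine (f x0))%:E by rewrite fineK// fin_numE f_proper.1 lt_eqF.
have d0_gt0 : 0 < d0.
  rewrite -zbar_proj normr_gt0 subr_eq0; apply/eqP => x0E.
  by apply: x0_nmin; rewrite x0E.
cbv zeta; set delta0 := fine (f x0 - f zbar).
have delta0E : delta0 = fine (f x0) - fine (f zbar).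
  by rewrite /delta0 fx0 fz -EFinB.
have delta0_gt0 : 0 < delta0.
  rewrite delta0E subr_gt0 -lte_fin -fx0 -fz lt_neqAle zbar_min andbT.
  apply/eqP => fE; apply: x0_nmin => y; rewrite -fE; exact: zbar_min.
rewrite fz leeBlDl// -EFinD.
have -> : t * kappa * Num.sqrt delta0 / (2 + 3 * kappa * Num.sqrt delta0) =
  t * (kappa / (2 + 3 * kappa * Num.sqrt delta0)) * Num.sqrt delta0 by ring.
apply: (value_decay hdot f_proper f_closed f_convex zbar_min theta_gt0 hsol
  d0_gt0) => //.
- by rewrite zbar_proj.
- by rewrite delta0E addrC subrK -fx0.
Qed.
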